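(* Let $n\ge 1$, $N=\{1,\dots,n\}$, let $A\subsetneq N$ and let $\alpha\in\mathcal{IS}_n$ be the idempotent with domain $A$, i.e. the identity map of $A$, so $\operatorname{rank}(\alpha)=|A|$. Consider the semigroup $(\mathcal{IS}_n,* )$ with $\beta*\gamma=\beta\alpha\gamma$. Put $\mathcal{C}_A=\{\beta\in\mathcal{IS}_n : \beta(A)=A\}$ and, for $x\in A$, let $\mathcal{G}(x)$ be the set of all $\lambda\in\mathcal{IS}_n$ such that $\lambda(x)\notin A$ (this includes the case that $\lambda$ is not defined at $x$) and, for all $y\in A\setminus\{x\}$, $\lambda(y)$ is defined and $\lambda(y)\in A\setminus\{x\}$. (i) If $\operatorname{rank}(\alpha)\ge 2$, then the isolated subsemigroups of $(\mathcal{IS}_n,* )$ are exactly $\mathcal{IS}_n$, $\mathcal{C}_A$, $\mathcal{IS}_n\setminus\mathcal{C}_A$ and $\mathcal{G}(x)$, $x\in A$. (ii) If $\operatorname{rank}(\alpha)=1$, then the isolated subsemigroups of $(\mathcal{IS}_n,* )$ are exactly $\mathcal{C}_A$, $\mathcal{IS}_n\setminus\mathcal{C}_A$ and $\mathcal{IS}_n$; in particular, all of them are completely isolated.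
   Context: $\mathcal{IS}_n$ is the symmetric inverse semigroup of all partial injective transformations of $N=\{1,\dots,n\}$ (including the nowhere defined map), under composition of partial maps. Products are composed from left to right, so $(\beta*\gamma)(x)=\gamma(\alpha(\beta(x)))$ whenever the right-hand side is defined. The rank of a partial injection is the cardinality of its domain. The condition $\beta(A)=A$ means that $\beta$ is defined on all of $A$ and maps $A$ bijectively onto $A$. A subsemigroup is a nonempty subset closed under the multiplication. A subsemigroup $T$ of a semigroup $S$ is isolated if for all $x\in S$, whenever $x^k\in T$ for some integer $k\ge 1$, then $x\in T$. It is completely isolated if for all $x,y\in S$, $xy\in T$ implies $x\in T$ or $y\in T$. Here powers and products are taken with respect to $*$. *)

(* Defs.v *)
From HB Require Import structures.
From mathcomp Require Import all_boot.

Set Implicit Arguments.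
Unset Strict Implicit.
Unset Printing Implicit Defensive.

Section Subsemigroups.

Local Open Scope group_scope.

Variable S : semigroupType.
Implicit Types (x y : S) (T : {pred S}).

(* The product of k copies of x, for k >= 1; a semigroup need not have a unit,
   so the value at k = 0 is a dummy (namely x). *)
Definition spow x k : S := iterop k *%g x x.

Lemma spow1 x : spow x 1 = x. Proof. by []. Qed.

Lemma spowSS x k : spow x k.+2 = x * spow x k.+1. Proof. by []. Qed.

Definition subsemigroup T := (exists x, x \in T) /\ mulg_closed T.

Definition isolated T := forall x k, 0 < k -> spow x k \in T -> x \in T.

Definition completely_isolated T :=
  forall x y, x * y \in T -> x \in T \/ y \in T.

Definition isolated_subsemigroup T := subsemigroup T /\ isolated T.

Definition completely_isolated_subsemigroup T :=
  subsemigroup T /\ completely_isolated T.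

End Subsemigroups.

(* Partial injections of 'I_n: f x = None means that f is undefined at x. *)
Definition partial_inj n (f : {ffun 'I_n -> option 'I_n}) : bool :=
  [forall x, forall y, (f x != None) && (f x == f y) ==> (x == y)].

Record symInv n := SymInv {
  symInv_val :> {ffun 'I_n -> option 'I_n};
  symInv_inj : partial_inj symInv_val }.

Notation "''IS_' n" := (symInv n)
  (at level 8, n at level 2, format "''IS_' n").

HB.instance Definition _ n := [isSub for @symInv_val n].
HB.instance Definition _ n := [Finite of 'IS_n by <:].

Section SymmetricInverseMonoid.

Variable n : nat.
Implicit Types (b c d : 'IS_n) (A : {set 'I_n}) (x y : 'I_n).

Lemma symInvP (f : {ffun 'I_n -> option 'I_n}) :
  reflect (forall x y z, f x = Some z -> f y = Some z -> x = y)
          (partial_inj f).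
Proof.
apply: (iffP 'forall_'forall_implyP) => [fI x y z fx fy | fI x y].
  by apply/eqP/fI; rewrite fx fy eqxx.
case/andP; case fx: (f x) => [z|//] _ /eqP fy.
by apply/eqP/(fI x y z); rewrite // -fy.
Qed.

Lemma comp_inj b c : partial_inj [ffun x => obind c (b x)].
Proof.
apply/symInvP => x y z; rewrite !ffunE.
case bx: (b x) => [u|] //=; case bY: (b y) => [v|] //= cu cv.
have uv : u = v by apply: (symInvP _ (symInv_inj c)) cu cv.
by apply: (symInvP _ (symInv_inj b)) bx _; rewrite bY uv.
Qed.

(* Products act from left to right: first b, then c. *)
Definition IS_mul b c : 'IS_n := SymInv (comp_inj b c).

Lemma IS_mulA : associative IS_mul.
Proof.
move=> b c d; apply/val_inj/ffunP => x; rewrite !ffunE.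
by case: (b x) => //= y; rewrite ffunE.
Qed.

HB.instance Definition _ := isSemigroup.Build 'IS_n IS_mulA.

Lemma pid_inj A : partial_inj [ffun x => if x \in A then Some x else None].
Proof.
apply/symInvP => x y z; rewrite !ffunE.
by case: ifP => // _ [->]; case: ifP => // _ [->].
Qed.

Definition pid A : 'IS_n := SymInv (pid_inj A).

Definition dom b : {set 'I_n} := [set x | b x != None].

Definition rank b : nat := #|dom b|.

(* b(A) = A; the equality of images in option 'I_n also forces b to be defined
   on the whole of A. *)
Definition stabC A : {set 'IS_n} :=
  [set b : 'IS_n | [set b x | x in A] == [set Some x | x in A]].

Definition setG A x : {set 'IS_n} :=
  [set l : 'IS_n |
     (if l x is Some z then z \notin A else true) &&
     [forall y in A :\ x, if l y is Some z then z \in A :\ x else false]].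

Lemma dom_pid A : dom (pid A) = A.
Proof. by apply/setP => x; rewrite inE ffunE; case: ifP. Qed.

Lemma rank_pid A : rank (pid A) = #|A|.
Proof. by rewrite /rank dom_pid. Qed.

Lemma pid_idem A : (pid A * pid A)%g = pid A.
Proof.
apply/val_inj/ffunP => x; rewrite !ffunE.
by case: ifP => //= xA; rewrite ffunE xA.
Qed.

Lemma idem_pid b : (b * b)%g = b -> b = pid (dom b).
Proof.
move=> bb; apply/val_inj/ffunP => x; rewrite ffunE inE.
case bx: (b x) => [y|] //=; congr Some.
have /ffunP/(_ x) := congr1 val bb; rewrite ffunE bx /= => bY.
exact: (symInvP _ (symInv_inj b)) bY bx.
Qed.

End SymmetricInverseMonoid.

(* An alias of 'IS_n carrying the sandwich multiplication (b, c) |-> b a c; the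
   sandwich element a is a parameter, so that the type determines the product. *)
Definition variant n (a : 'IS_n) : Type := 'IS_n.

HB.instance Definition _ n (a : 'IS_n) := Finite.on (variant a).

Section Variant.

Local Open Scope group_scope.

Variables (n : nat) (a : 'IS_n).

Definition variant_mul (b c : variant a) : variant a :=
  ((b : 'IS_n) * a * (c : 'IS_n) : 'IS_n).

Lemma variant_mulA : associative variant_mul.
Proof. by move=> b c d; rewrite /variant_mul !mulgA. Qed.

HB.instance Definition _ := isSemigroup.Build (variant a) variant_mulA.

End Variant.

(* Main.v *)
Require Import Defs.
From mathcomp Require Import all_boot perm.

Set Implicit Arguments.
Unset Strict Implicit.
Unset Printing Implicit Defensive.

(** An isolated subsemigroup T of a finite semigroup contains an element exactly
    when it contains the idempotent among the powers of that element, so T is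
    known once its idempotents are known. The idempotents of the variant are the
    [pid B] with B a subset of A, and the idempotent power of u is [pid B] for
    the largest subset B of A that u permutes. So T amounts to a family F of subsets
    of A, stable under intersection, and the subsemigroups of the theorem are
    those whose families are all subsets of A, A alone, all proper subsets, and
    A :\ x alone ([pid_stabC], [pid_setG]).

    Two closure properties of F come from partial transpositions, elements whose
    square is already idempotent:
    - if B is in F and x, y are distinct points of A outside B, then x |: B is
      in F: the maps fixing B pointwise and sending x to y only, resp. y to x only,
      have square [pid B], while their product is [pid (x |: B)] ([pid_add]);
    - if B is a proper subset of C, both in F, then F contains every B :\ x:
      transposing x with a point of C outside B is an element whose square is
      [pid C], and following it by [pid B] gives an element whose square is
      [pid (B :\ x)] ([pid_remove]).

    Hence a family with two members contains the empty set, by removing points,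
    and a family that contains the empty set contains every proper subset of A,
    by adding points, so that only the membership of A is left to decide. In the
    remaining case the family has a single member B, which misses at most one
    point of A, as otherwise a point could be added to B; so B is A or some
    A :\ x. When A is a singleton, A :\ x is empty and [setG A x] is the
    complement of [stabC A]. *)

(** * Powers in a semigroup *)

Section Powers.

Local Open Scope group_scope.

Variable S : semigroupType.
Implicit Types (x : S) (T : {pred S}).

Lemma spowD x i j : spow x i.+1 * spow x j.+1 = spow x (i.+1 + j.+1).
Proof.
elim: i => [|i IHi]; first by rewrite spow1 spowSS.
by rewrite spowSS -mulgA IHi.
Qed.

Lemma spow_closed T x k : mulg_closed T -> 0 < k -> x \in T -> spow x k \in T.
Proof.
move=> mulT k_gt0 xT; case: k k_gt0 => // k _.
by elim: k => [|k IHk] //; rewrite spowSS; apply: mulT.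
Qed.

(** With d = j - i, the powers of x from the i-th on repeat with period d; the
    exponent i * d is past that threshold and a multiple of the period, so
    doubling it does not change the power. *)
Lemma spow_idem x i j :
  0 < i < j -> spow x i = spow x j ->
  exists2 k, 0 < k & spow x k * spow x k = spow x k.
Proof.
case/andP; case: i => // i _ ltij eqij.
have per m q : i.+1 <= m -> spow x (m + q * (j - i.+1)) = spow x m.
  elim: q => [|q IHq] lem; first by rewrite addn0.
  rewrite -[RHS]IHq // mulSn addnCA addnC.
  have : i.+1 <= m + q * (j - i.+1) by rewrite (leq_trans lem) ?leq_addr.
  move: (m + _) => p; rewrite leq_eqVlt => /predU1P[<-|ltip].
    by rewrite subnKC ?(ltnW ltij).
  have -> : p = i.+1 + (p - i.+2).+1 by rewrite -subSn // subSS subnKC // ltnW.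
  have -> : i.+1 + (p - i.+2).+1 + (j - i.+1) = (j.-1).+1 + (p - i.+2).+1.
    by rewrite addnAC subnKC ?(ltnW ltij) // (ltn_predK ltij).
  by rewrite -!spowD eqij (ltn_predK ltij).
have d_gt0 : 0 < j - i.+1 by rewrite subn_gt0.
exists (i.+1 * (j - i.+1))%N; first by rewrite muln_gt0.
have k_gt0 : 0 < (i.+1 * (j - i.+1))%N by rewrite muln_gt0.
by rewrite -(prednK k_gt0) spowD (prednK k_gt0) per // leq_pmulr.
Qed.

Lemma isolated_spow T x k :
  isolated_subsemigroup T -> 0 < k -> (spow x k \in T) = (x \in T).
Proof.
case=> -[_ mulT] isoT k_gt0.
by apply/idP/idP => [/isoT|/(spow_closed mulT)]; apply.
Qed.

(** Under this hypothesis both T and its complement are closed under products,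
    and T is isolated together with its complement. *)
Lemma prime_spow T x k : (forall y z, (y * z \in T) = (y \in T) && (z \in T)) ->
  0 < k -> (spow x k \in T) = (x \in T).
Proof.
move=> primeT; case: k => // k _.
by elim: k => [|k IHk] //; rewrite spowSS primeT IHk andbb.
Qed.

End Powers.

Section Variant.

Local Open Scope group_scope.

Variables (n : nat) (A : {set 'I_n}).

Local Notation V := (variant (pid A)).
Implicit Types (b : 'IS_n) (u v w : V) (B C : {set 'I_n}) (T : {set V}).

Lemma symInv_eq b x y z : b x = Some z -> b y = Some z -> x = y.
Proof. exact: (symInvP _ (symInv_inj b)). Qed.

Lemma pidE B x : pid B x = if x \in B then Some x else None.
Proof. by rewrite ffunE. Qed.

Lemma variantE u v x :
  (u * v) x = obind (fun y => if y \in A then v y else None) (u x).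
Proof.
by rewrite !ffunE; case: (u x) => //= y; rewrite pidE; case: ifP.
Qed.

(** * Idempotents *)

(** If u is idempotent and u x = y, then the product passes through y in A and
    u y = y; injectivity of u gives x = y. *)
Lemma variant_idem u :
  u * u = u -> exists2 B : {set 'I_n}, B \subset A & u = pid B.
Proof.
move=> uu.
have fixu x y : u x = Some y -> y = x /\ x \in A.
  move=> ux; have := congr1 (fun w : V => w x) uu.
  rewrite variantE ux /=; case: ifP => // yA uy.
  by have eqxy := symInv_eq uy ux; rewrite -eqxy.
exists (dom (u : 'IS_n)).
  apply/subsetP=> x; rewrite inE; case ux: (u x) => [y|] // _.
  by case: (fixu x y ux).
apply/val_inj/ffunP=> x; rewrite ffunE inE; case ux: (u x) => [y|] //=.
by case: (fixu x y ux) => ->.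
Qed.

Lemma idem_power u :
  exists2 k, 0 < k & exists2 B : {set 'I_n}, B \subset A & spow u k = pid B.
Proof.
pose f (i : 'I_#|{: V}|.+1) := spow u i.+1.
have /injectivePn[i [j neij eqf]] : ~~ injectiveb f.
  by apply/negP=> /injectiveP/leq_card; rewrite card_ord ltnn.
wlog ltij : i j neij eqf / i < j.
  move=> IH; case: (ltngtP i j) => [|gtij|/val_inj eqij]; first exact: IH.
    by apply: IH gtij; rewrite 1?eq_sym.
  by rewrite eqij eqxx in neij.
have [k k_gt0 /variant_idem idk] := @spow_idem _ u i.+1 j.+1 ltij eqf.
by exists k.
Qed.

(** The reduction to idempotents: T1 and T2 contain an element exactly when they
    contain its idempotent power. *)
Lemma eq_isolated (T1 T2 : {set V}) :
    isolated_subsemigroup T1 -> isolated_subsemigroup T2 ->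
    (forall B, B \subset A -> (pid B \in T1) = (pid B \in T2)) ->
  T1 = T2.
Proof.
move=> iso1 iso2 eqT; apply/setP=> u.
have [k k_gt0 [B sBA powu]] := idem_power u.
by rewrite -(isolated_spow u iso1 k_gt0) -(isolated_spow u iso2 k_gt0) powu eqT.
Qed.

(** * The subsemigroups of the list are isolated *)

Lemma stabCP b :
  reflect (forall x, x \in A -> exists2 y, y \in A & b x = Some y)
          (b \in stabC A).
Proof.
rewrite inE; apply: (iffP eqP) => [eqA x xA | bA].
  by have /setP/(_ (b x)) := eqA; rewrite imset_f // => /esym/imsetP.
apply/eqP; rewrite eqEcard; apply/andP; split.
  apply/subsetP=> _ /imsetP[x /bA[y yA ->] ->]; exact: imset_f.
rewrite (card_imset _ (@Some_inj _)) card_in_imset // => x y /bA[z _ bx] _ eqb.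
by apply: (@symInv_eq b x y z); rewrite // -eqb.
Qed.

Lemma stabC_onto b y :
  b \in stabC A -> y \in A -> exists2 x, x \in A & b x = Some y.
Proof.
rewrite inE => /eqP eqA yA.
have : Some y \in [set Some x | x in A] by exact: imset_f.
by rewrite -eqA => /imsetP[x xA ->]; exists x.
Qed.

(** The first factor of a product must map A into A for the product to permute
    A, hence permutes A by finiteness; it is then onto A, which forces the second
    factor to be defined on A with values in A. *)
Lemma stabCM u v :
  (u * v \in stabC A) = (u \in stabC A) && (v \in stabC A).
Proof.
apply/idP/andP => [/stabCP uvA | [/stabCP uA /stabCP vA]]; last first.
  apply/stabCP=> x /uA[y yA ux]; have [z zA vy] := vA y yA.
  by exists z; rewrite // variantE ux /= yA.
have uA : u \in stabC A.
  apply/stabCP=> x /uvA[z _]; rewrite variantE; case: (u x) => //= y.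
  by case: ifP => // yA _; exists y.
split=> //; apply/stabCP=> y yA; have [x xA ux] := stabC_onto uA yA.
by have [z zA] := uvA x xA; rewrite variantE ux /= yA; exists z.
Qed.

Lemma pid_stabC B : B \subset A -> (pid B \in stabC A) = (B == A).
Proof.
move=> sBA; apply/stabCP/eqP=> [fixA | -> x xA]; last first.
  by exists x; rewrite ?pidE ?xA.
apply/eqP; rewrite eqEsubset sBA; apply/subsetP=> x /fixA[y _].
by rewrite pidE; case: ifP.
Qed.

Lemma stabC_isolated : isolated_subsemigroup (stabC A : {set V}).
Proof.
split; first split; first by exists (pid A); rewrite pid_stabC.
  by move=> u v uC vC; rewrite /= stabCM uC.
by move=> u k k_gt0; rewrite (prime_spow _ stabCM).
Qed.

Lemma setC_stabC_isolated :
  A != set0 -> isolated_subsemigroup (~: stabC A : {set V}).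
Proof.
move=> A_neq0; split; first split.
- by exists (pid set0); rewrite in_setC pid_stabC ?sub0set // eq_sym.
- by move=> u v; rewrite !in_setC stabCM negb_and => ->.
- by move=> u k k_gt0; rewrite !in_setC (prime_spow _ stabCM).
Qed.

Lemma setT_isolated : isolated_subsemigroup [set: V].
Proof.
split; last by move=> u k _ _; rewrite inE.
by split=> [|u v]; [exists (pid A : V); rewrite inE | rewrite !inE].
Qed.

Lemma setGP b x :
  reflect ((forall z, b x = Some z -> z \notin A) /\
           (forall y, y \in A :\ x -> exists2 z, z \in A :\ x & b y = Some z))
          (b \in setG A x).
Proof.
rewrite inE; apply: (iffP andP) => -[bx /= bA]; split.
- by move=> z eqz; rewrite eqz in bx.
- move=> y yA; have /forall_inP/(_ y yA) := bA.
  by case: (b y) => // z; exists z.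
- by case: (b x) bx => // z; apply.
- by apply/forall_inP=> y /bA[z zA ->].
Qed.

Lemma pid_setG B x :
  B \subset A -> x \in A -> (pid B \in setG A x) = (B == A :\ x).
Proof.
move=> sBA xA; apply/setGP/eqP=> [[Bx fixA] | ->].
  apply/eqP; rewrite eqEsubset subsetD1 sBA /=; apply/andP; split.
    by apply/negP=> xB; have := Bx x; rewrite pidE xB xA => /(_ erefl).
  by apply/subsetP=> y /fixA[z _]; rewrite pidE; case: ifP.
by split=> [z|y yA]; rewrite pidE; [rewrite !inE eqxx | rewrite yA; exists y].
Qed.

Lemma setG_isolated x : x \in A -> isolated_subsemigroup (setG A x : {set V}).
Proof.
move=> xA; split; first split.
- by exists (pid (A :\ x)); rewrite pid_setG ?subD1set.
- move=> u v /setGP[ux uA] /setGP[_ vA].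
  apply/setGP; split=> [z | y /uA[z zA uy]].
    by rewrite variantE; case: (u x) ux => //= t /(_ t erefl)/negPf ->.
  have [t tA vz] := vA z zA; exists t => //.
  by rewrite variantE uy /=; case/setD1P: zA => _ ->.
move=> u [|[|k]] // _ /setGP[powx powA].
(* A power of exponent at least 2 is defined at a point of A only if u maps this
   point into A. *)
have uA y : y \in A :\ x -> exists2 z, z \in A & u y = Some z.
  move=> /powA[z _]; rewrite spowSS variantE; case: (u y) => //= t.
  by case: ifP => // tA _; exists t.
(* If u x were in A as well, then u would permute A, and so would its powers. *)
have ux z : u x = Some z -> z \notin A.
  move=> eqz; apply/negP=> zA.
  have: spow u k.+2 \in stabC A.
    rewrite (prime_spow _ stabCM) //; apply/stabCP=> y yA.
    have [->|neyx] := eqVneq y x; first by exists z.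
    by apply: uA; rewrite !inE neyx.
  by move=> /stabCP/(_ x xA)[t tA /powx]; rewrite tA.
(* If u y were x, then the power would send y, through x, to the value at x of a
   power of u, and u x is not in A. *)
apply/setGP; split=> // y yA; have [z zA uy] := uA y yA.
exists z => //; rewrite !inE zA andbT; apply/eqP=> eqz.
have [t /setD1P[_ tA]] := powA y yA; rewrite spowSS variantE uy /= zA eqz.
case: k {powx powA} => [|k]; first by move/ux; rewrite tA.
by rewrite variantE; case: (u x) ux => //= s /(_ s erefl)/negPf ->.
Qed.

Lemma setG_set1 x : A = [set x] -> setG A x = ~: stabC A :> {set V}.
Proof.
move=> defA; have xA : x \in A by rewrite defA set11.
have A_neq0 : A != set0 by apply/set0Pn; exists x.
apply: eq_isolated (setG_isolated xA) (setC_stabC_isolated A_neq0) _ => B sBA.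
rewrite pid_setG // in_setC pid_stabC // defA setDv -defA.
move: sBA; rewrite {1}defA subset1 => /predU1P[->|/eqP ->]; rewrite -?defA.
  by rewrite eqxx (negPf A_neq0).
by rewrite eq_sym A_neq0 eqxx.
Qed.

Lemma stabC_completely_isolated T :
    [\/ T = stabC A, T = ~: stabC A | T = [set: V]] ->
  completely_isolated T.
Proof.
case=> -> u v; rewrite ?in_setC ?stabCM; last by left; rewrite inE.
  by case/andP; left.
by rewrite negb_and => /orP.
Qed.

(** * Restrictions of permutations *)

Lemma pperm_inj (s : 'S_n) B :
  partial_inj [ffun x => if x \in B then Some (s x) else None].
Proof.
apply/symInvP=> x y z; rewrite !ffunE; case: ifP => // _ [<-].
by case: ifP => // _ [/perm_inj].
Qed.

Definition pperm s B : V := SymInv (pperm_inj s B).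

Lemma pperm1 B : pperm 1 B = pid B.
Proof. by apply/val_inj/ffunP=> x; rewrite !ffunE perm1. Qed.

Lemma ppermM s t B C :
  C \subset A -> pperm s B * pperm t C = pperm (s * t) [set x in B | s x \in C].
Proof.
move=> sCA; apply/val_inj/ffunP=> x; rewrite variantE !ffunE inE permM.
case: (x \in B) => //=; rewrite !ffunE.
by case: ifP; case: ifP => // /(subsetP sCA) ->.
Qed.

Lemma pperm_tperm_sqr x y B :
    B \subset A ->
  spow (pperm (tperm x y) B) 2 = pid [set z in B | tperm x y z \in B].
Proof. by move=> sBA; rewrite spowSS spow1 ppermM // tperm2 pperm1. Qed.

(** * Classification *)

Section Isolated.

Variable T : {set V}.
Hypothesis isoT : isolated_subsemigroup T.

Let mulT u v : u \in T -> v \in T -> u * v \in T.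
Proof. by case: isoT => -[_ mulT] _ uT vT; apply: mulT. Qed.

(** The square of a partial transposition is idempotent, so it decides the
    membership of the transposition in an isolated subsemigroup. *)
Lemma pperm_tperm_mem x y B : B \subset A ->
  (pperm (tperm x y) B \in T) = (pid [set z in B | tperm x y z \in B] \in T).
Proof.
by move=> sBA; rewrite -(isolated_spow _ isoT (ltn0Sn 1)) pperm_tperm_sqr.
Qed.

(** The maps t : x -> y and t' : y -> x, both fixing B pointwise, have square
    [pid B]: x, resp. y, leaves the domain after one step. Their product t t'
    fixes x as well. *)
Lemma pid_add B x y :
    B \subset A -> x \in A :\: B -> y \in A :\: B -> x != y -> pid B \in T ->
  pid (x |: B) \in T.
Proof.
move=> sBA /setDP[xA xB] /setDP[yA yB] nexy BT.
have half z t : z \in [set x; y] -> t \in [set x; y] -> z != t ->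
    pperm (tperm z t) (z |: B) \in T.
  move=> zxy txy nezt.
  have [zA zB] : z \in A /\ z \notin B by case/set2P: zxy => ->.
  have tB : t \notin B by case/set2P: txy => ->.
  rewrite pperm_tperm_mem ?subUset ?sub1set ?zA //.
  suff -> : [set s in z |: B | tperm z t s \in z |: B] = B by [].
  apply/setP=> s; rewrite !inE; case: tpermP => [->|->|/eqP/negPf-> _].
  - by rewrite (negPf zB) (negPf tB) eq_sym (negPf nezt) andbF.
  - by rewrite (negPf tB) eq_sym (negPf nezt).
  - by rewrite andbb.
have := mulT (half x y (set21 x y) (set22 x y) nexy)
             (half y x (set22 x y) (set21 x y) _).
rewrite tpermC ppermM ?subUset ?sub1set ?yA // tperm2 pperm1.
suff -> : [set s in x |: B | tperm y x s \in y |: B] = x |: B.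
  by apply; rewrite eq_sym.
apply/setP=> s; rewrite !inE; case: tpermP => [->|->|/eqP/negPf-> /eqP/negPf->].
- by rewrite (negPf yB) eq_sym (negPf nexy).
- by rewrite !eqxx.
- by rewrite /= andbb.
Qed.

(** Let z be a point of C outside B. The transposition of x and z on C has
    square [pid C]; followed by [pid B] it sends z to x, is undefined at x, and
    fixes the rest of B, so that its square is [pid (B :\ x)]. *)
Lemma pid_remove B C x :
  C \subset A -> B \proper C -> pid B \in T -> pid C \in T -> x \in B ->
  pid (B :\ x) \in T.
Proof.
move=> sCA /properP[sBC [z zC zB]] BT CT xB.
(* C contains both x and z, so the transposition permutes it. *)
have swapT : pperm (tperm x z) C \in T.
  rewrite pperm_tperm_mem //.
  suff -> : [set s in C | tperm x z s \in C] = C by [].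
  apply/setP=> s; rewrite inE.
  case: tpermP => [->|->|_ _]; rewrite ?zC ?andbT ?andbb //.
  by rewrite (subsetP sBC _ xB).
have sBA := subset_trans sBC sCA.
have := mulT swapT BT; rewrite -(pperm1 B) ppermM // mulg1.
set E := [set s in C | _]; have sEA : E \subset A.
  by apply/subsetP=> s; rewrite inE => /andP[/(subsetP sCA)].
rewrite pperm_tperm_mem //.
suff -> : [set s in E | tperm x z s \in E] = B :\ x by [].
apply/setP=> s; rewrite !inE tpermK.
case: tpermP => [->|->|/eqP-> _].
- by rewrite (negPf zB) andbF eqxx.
- by rewrite (negPf zB) !andbF.
- by case sB: (s \in B); rewrite ?andbF //= (subsetP sBC _ sB).
Qed.

Lemma pid0_mem B C :
  C \subset A -> B \proper C -> pid B \in T -> pid C \in T -> pid set0 \in T.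
Proof.
move=> sCA; have [m] := ubnP #|B|; elim: m B => // m IHm B leB ltBC BT CT.
have [<- //|[x xB]] := set_0Vmem B.
apply: (IHm (B :\ x)) (CT); last exact: pid_remove ltBC BT CT xB.
  by rewrite [#|B|](cardsD1 x) xB in leB.
exact: sub_proper_trans (subD1set B x) ltBC.
Qed.

(** A point y of A outside B stays available while the points of B are added to
    the empty set one by one, as [pid_add] requires. *)
Lemma pid_proper_mem B : pid set0 \in T -> B \proper A -> pid B \in T.
Proof.
move=> T0; have [m] := ubnP #|B|; elim: m B => // m IHm B leB ltBA.
have [-> //|[x xB]] := set_0Vmem B.
have /properP[sBA [y yA yB]] := ltBA.
have sB1A : B :\ x \proper A := sub_proper_trans (subD1set B x) ltBA.
rewrite -(setD1K xB); apply: (pid_add (y := y)) (proper_sub sB1A) _ _ _ _.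
- by rewrite !inE eqxx (subsetP sBA).
- by rewrite !inE (negPf yB) andbF.
- by apply: contraNneq yB => <-.
- by apply: IHm; rewrite // [#|B|](cardsD1 x) xB in leB.
Qed.

(** If the family of T contains the empty set, then T is determined by whether
    it contains [pid A]; otherwise the family has a single member. *)
Lemma isolated_class :
  [\/ T = [set: V], T = stabC A, T = ~: stabC A
    | exists2 x : 'I_n, x \in A & T = setG A x].
Proof.
have [T0 | T'0] := boolP (pid set0 \in T).
  have [TA | T'A] := boolP (pid A \in T).
    constructor 1; apply: eq_isolated isoT setT_isolated _ => B sBA.
    rewrite [RHS]inE; have [->|neBA] := eqVneq B A; first exact: TA.
    by rewrite pid_proper_mem // properEneq neBA.
  have A_neq0 : A != set0 by apply: contraNneq T'A => ->.
  constructor 3.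
  apply: eq_isolated isoT (setC_stabC_isolated A_neq0) _ => B sBA.
  rewrite in_setC pid_stabC //.
  have [->|neBA] := eqVneq B A; first exact: negbTE.
  by rewrite pid_proper_mem // properEneq neBA.
have [B sBA BT] : exists2 B : {set 'I_n}, B \subset A & pid B \in T.
  case: isoT => -[[u uT] _] _; have [k k_gt0 [B sBA powu]] := idem_power u.
  by exists B; rewrite // -powu (isolated_spow _ isoT).
(* Two distinct members of the family give a proper inclusion between members,
   after replacing one of them by their intersection if needed. *)
have uniqB C : C \subset A -> (pid C \in T) = (C == B).
  move=> sCA; apply/idP/eqP=> [CT | -> //]; apply: contraNeq T'0 => neCB.
  have ICT : pid (C :&: B) \in T.
    have := mulT CT BT; rewrite -(pperm1 C) -(pperm1 B) ppermM // mulg1.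
    suff -> : [set s in C | (1 : 'S_n) s \in B] = C :&: B by rewrite pperm1.
    by apply/setP=> s; rewrite !inE perm1.
  have [sCB | nsCB] := boolP (C \subset B).
    by apply: (pid0_mem sBA) CT BT; rewrite properEneq neCB.
  apply: pid0_mem sCA _ ICT CT; rewrite properEneq subsetIl andbT.
  by apply: contra nsCB => /eqP/setIidPl.
(* From here on [pid B] is the only idempotent of T. *)
have [sAB | /subsetPn[x xA xB]] := boolP (A \subset B).
  have eqBA : B = A by apply/eqP; rewrite eqEsubset sBA.
  constructor 2; apply: eq_isolated isoT stabC_isolated _ => C sCA.
  by rewrite uniqB // pid_stabC // eqBA.
constructor 4; exists x => //.
apply: eq_isolated isoT (setG_isolated xA) _ => C sCA.
rewrite uniqB // pid_setG //; congr (C == _); apply/eqP.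
rewrite eqEsubset subsetD1 sBA xB; apply/subsetP=> y /setD1P[neyx yA].
(* A second point of A outside B would allow x to be added to B. *)
apply: contraNT T'0 => yB.
have xBT : pid (x |: B) \in T.
  by apply: (pid_add (y := y)) BT; rewrite // 1?eq_sym // inE ?xA ?yA ?xB ?yB.
apply: pid0_mem _ _ BT xBT; first by rewrite subUset sub1set xA.
by rewrite properUr // sub1set.
Qed.

End Isolated.

End Variant.

Theorem theorem6 (n : nat) (A : {set 'I_n}) :
  0 < n -> A \proper [set: 'I_n] ->
  (2 <= rank (pid A) ->
     forall T : {set variant (pid A)},
       isolated_subsemigroup T <->
       [\/ T = [set: 'IS_n], T = stabC A, T = ~: stabC A
         | exists2 x : 'I_n, x \in A & T = setG A x])
  /\
  (rank (pid A) = 1 ->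
     (forall T : {set variant (pid A)},
        isolated_subsemigroup T <->
        [\/ T = stabC A, T = ~: stabC A | T = [set: 'IS_n]]) /\
     (forall T : {set variant (pid A)},
        isolated_subsemigroup T -> completely_isolated_subsemigroup T)).
Proof.
move=> _ _; rewrite rank_pid.
have A_neq0 : 0 < #|A| -> A != set0 by rewrite card_gt0.
split=> [A_gt1 T | /eqP/cards1P[x defA]].
  split=> [|[->|->|->|[x xA ->]]]; first exact: isolated_class.
  - exact: setT_isolated.
  - exact: stabC_isolated.
  - exact/setC_stabC_isolated/A_neq0/ltnW.
  - exact: setG_isolated.
have class1 (T : {set variant (pid A)}) :
    isolated_subsemigroup T ->
    [\/ T = stabC A, T = ~: stabC A | T = [set: 'IS_n]].
  move=> /isolated_class[->|->|->|[y yA ->]]; [by constructor..|].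
  constructor 2; apply: setG_set1.
  by move: yA; rewrite {1}defA => /set1P ->.
split=> T; last first.
  move=> isoT; split; first by case: isoT.
  exact/stabC_completely_isolated/class1.
split=> [|[->|->|->]]; first exact: class1.
- exact: stabC_isolated.
- by apply: setC_stabC_isolated; rewrite A_neq0 // defA cards1.
- exact: setT_isolated.
Qed.
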